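(* Let $\{X_n:n\in\mathbb{N}\}$ be a sequence of arbitrary non-trivial (i.e. nonzero) Banach spaces, let $1<p<\infty$, and write $X_p:=\left[\bigoplus_{n=1}^{\infty}X_n\right]_{\ell_p}$. Then $0\in\mathrm{SCD}(B_{X_p})$.
   Context: Banach spaces are over $\mathbb{K}=\mathbb{R}$ or $\mathbb{C}$; $B_X$ and $X^*$ denote the closed unit ball and the topological dual of $X$. A slice of a bounded set $A\subseteq X$ is a non-empty intersection of $A$ with an open half-space; it can be written as $S(A,x^*,\alpha)=\{x\in A:\operatorname{Re}x^*(x)>\sup_{b\in A}\operatorname{Re}x^*(b)-\alpha\}$ with $x^*\in X^*$, $\alpha>0$. Let $A\subseteq X$ be bounded and convex and $a\in A$. A countable collection $\{V_n:n\in\mathbb{N}\}$ of non-empty subsets of $A$ is determining for $a$ if $a\in\overline{\mathrm{conv}}(B)$ whenever $B\subseteq A$ intersects all the sets $V_n$. The point $a$ is an SCD point (slicely countably determined point) of $A$ if there is a sequence of slices of $A$ that is determining for $a$; $\mathrm{SCD}(A)$ is the set of all SCD points of $A$. $\left[\bigoplus_{n=1}^{\infty}X_n\right]_{\ell_p}$ is the Banach space of all $(x_n)\in\prod_{n=1}^\infty X_n$ with $\|(x_n)\|:=\left(\sum_{n=1}^\infty\|x_n\|^p\right)^{1/p}<\infty$. *)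

(* Defs.v *)
From HB Require Import structures.
From mathcomp Require Import all_boot all_order all_algebra.
From mathcomp Require Import complex ring lra.
From mathcomp Require Import all_classical all_reals all_analysis.

Set Implicit Arguments.
Unset Strict Implicit.
Unset Printing Implicit Defensive.

Import Order.TTheory GRing.Theory Num.Theory.
Import numFieldNormedType.Exports.

Local Open Scope classical_set_scope.
Local Open Scope ring_scope.

(* A normed module takes its norm in its scalar field, so the field itself, and
   not only a predicate on it, has to range over R and C. *)
Variant scalar_kind := real_scalars | complex_scalars.

Definition scalars (R : realType) (b : scalar_kind) : numFieldType :=
  match b with
  | real_scalars => R
  | complex_scalars => R[i]
  end.

Definition realpart (R : realType) (b : scalar_kind) : scalars R b -> R :=
  match b return scalars R b -> R with
  | real_scalars => fun x => x
  | complex_scalars => fun z => complex.Re z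
  end.

Definition of_real (R : realType) (b : scalar_kind) : R -> scalars R b :=
  match b return R -> scalars R b with
  | real_scalars => fun x => x
  | complex_scalars => fun x => Complex x 0
  end.
Arguments of_real {R b}.

Section ScalarTheory.
Context {R : realType} {b : scalar_kind}.
Implicit Types (x y : R) (z w : scalars R b).

Lemma of_realK : cancel (@of_real R b) (@realpart R b).
Proof. by case: b. Qed.

Lemma of_realD x y : of_real (x + y) = of_real x + of_real y :> scalars R b.
Proof.
by case: b => //=; apply/eqP; rewrite eq_complex /= addr0 !eqxx.
Qed.

Lemma of_realM x y : of_real (x * y) = of_real x * of_real y :> scalars R b.
Proof.
by case: b => //=; apply/eqP; rewrite eq_complex /= !mulr0 !mul0r subr0 addr0 !eqxx.
Qed.

Lemma of_real0 : of_real 0 = 0 :> scalars R b.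
Proof. by case: b. Qed.

Lemma ler_of_real x y : (of_real x <= of_real y :> scalars R b) = (x <= y).
Proof. by case: b => //=; rewrite lecE /= eqxx. Qed.

Lemma ltr_of_real x y : (of_real x < of_real y :> scalars R b) = (x < y).
Proof. by case: b => //=; rewrite ltcE /= eqxx. Qed.

Lemma realpartD : {morph @realpart R b : z w / z + w}.
Proof. by case: b => //= -[a c] [a' c']. Qed.

Lemma realpartN : {morph @realpart R b : z / - z}.
Proof. by case: b => //= -[a c]. Qed.

Lemma realpartK z : 0 <= z -> of_real (realpart z) = z.
Proof.
by case: b z => //= -[a c]; rewrite lecE /= => /andP[/eqP -> _].
Qed.

Lemma ler_realpart z w : z <= w -> realpart z <= realpart w.
Proof. by case: b z w => //= -[a c] [a' c']; rewrite lecE /= => /andP[]. Qed.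

Lemma realpart_ge0 z : 0 <= z -> 0 <= realpart z.
Proof. by move=> /ler_realpart; rewrite -{1}of_real0 of_realK. Qed.

Lemma realpart0 : realpart (0 : scalars R b) = 0.
Proof. by rewrite -of_real0 of_realK. Qed.

Lemma realpartMge0 z w : 0 <= z -> 0 <= w ->
  realpart (z * w) = realpart z * realpart w.
Proof.
move=> z0 w0; rewrite -{1}(realpartK z0) -{1}(realpartK w0) -of_realM.
by rewrite of_realK.
Qed.

Lemma realpart_eq0 z : 0 <= z -> realpart z = 0 -> z = 0.
Proof. by move=> z0 rz; rewrite -(realpartK z0) rz of_real0. Qed.

End ScalarTheory.

(* Norms of normed modules over K take values in K; rnorm is the same norm
   seen in R. *)
Definition rnorm (R : realType) (b : scalar_kind)
  (V : normedModType (scalars R b)) (x : V) : R := realpart `|x|.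

Section RealNorm.
Context {R : realType} {b : scalar_kind} {V : normedModType (scalars R b)}.
Implicit Types (x y : V).

Lemma rnorm_ge0 x : 0 <= rnorm x.
Proof. exact: realpart_ge0. Qed.

Lemma ler_rnormD x y : rnorm (x + y) <= rnorm x + rnorm y.
Proof. by rewrite /rnorm -realpartD; apply: ler_realpart; exact: ler_normD. Qed.

Lemma rnormN x : rnorm (- x) = rnorm x.
Proof. by rewrite /rnorm normrN. Qed.

Lemma rnormZ (l : scalars R b) x : rnorm (l *: x) = realpart `|l| * rnorm x.
Proof. by rewrite /rnorm normrZ realpartMge0. Qed.

Lemma rnorm0 : rnorm (0 : V) = 0.
Proof. by rewrite /rnorm normr0 realpart0. Qed.

Lemma rnorm_eq0 x : rnorm x = 0 -> x = 0.
Proof. by move=> /(realpart_eq0 (normr_ge0 x)) /normr0_eq0. Qed.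

Lemma rnormE x : of_real (rnorm x) = `|x|.
Proof. exact: realpartK. Qed.

End RealNorm.

Section ScalarLp.
Context {R : realType} (p : R) (p1 : 1 <= p).
Local Open Scope ereal_scope.
Implicit Types (u v : nat -> R).

Let p0 : (0 < p)%R. Proof. exact: lt_le_trans p1. Qed.

Definition lp_sum u : \bar R := \sum_(k <oo) ((u k `^ p)%R)%:E.

Lemma lp_sum_ge0 u : 0 <= lp_sum u.
Proof. by apply: nneseries_ge0 => k _ _; rewrite lee_fin powR_ge0. Qed.

Lemma lp_sum_fin u : lp_sum u < +oo -> lp_sum u \is a fin_num.
Proof. by rewrite ge0_fin_numE ?lp_sum_ge0. Qed.

Lemma le_lp_sum u v : (forall k, 0 <= u k <= v k)%R -> lp_sum u <= lp_sum v.
Proof.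
move=> uv; apply: lee_nneseries => k _; first by move=> _; rewrite lee_fin powR_ge0.
have /andP[u0 uvk] := uv k.
by rewrite lee_fin ge0_ler_powR// ?nnegrE ?(ltW p0)// (le_trans u0).
Qed.

Lemma lp_sumZ u (c : R) : (0 <= c)%R -> (forall k, 0 <= u k)%R ->
  lp_sum (fun k => c * u k)%R = (c `^ p)%:E * lp_sum u.
Proof.
move=> c0 u0; rewrite /lp_sum -nneseriesZl; last first.
- by move=> i _; rewrite lee_fin powR_ge0.
- by apply: eq_eseriesr => k _; rewrite powRM// EFinM.
Qed.

Lemma lp_sum0 : lp_sum (fun=> 0)%R = 0.
Proof. by apply: eseries0 => k _ _; rewrite powR0 ?gt_eqF. Qed.

Lemma ler_lp_sum_coord u k : (u k `^ p)%:E <= lp_sum u.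
Proof.
rewrite /lp_sum (nneseriesD1 (n := k))//; last first.
  by move=> i _; rewrite lee_fin powR_ge0.
by rewrite leeDl// nneseries_ge0// => i _ _; rewrite lee_fin powR_ge0.
Qed.

Lemma lp_minkowski u v : (forall k, 0 <= u k)%R -> (forall k, 0 <= v k)%R ->
  lp_sum (fun k => u k + v k)%R `^ p^-1 <=
  lp_sum u `^ p^-1 + lp_sum v `^ p^-1.
Proof.
move=> u0 v0.
have LE w : (forall k, 0 <= w k)%R ->
    Lnorm counting p%:E (EFin \o w) = lp_sum w `^ p^-1.
  move=> w0; rewrite Lnorm_counting//; congr (_ `^ _).
  by apply: eq_eseriesr => k _ /=; rewrite ger0_norm.
rewrite -!LE//; last by move=> k; rewrite addr_ge0.
exact: (@minkowski_EFin _ _ _ counting u v p).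
Qed.

Lemma lp_sumD_lty u v : (forall k, 0 <= u k)%R -> (forall k, 0 <= v k)%R ->
  lp_sum u < +oo -> lp_sum v < +oo -> lp_sum (fun k => u k + v k)%R < +oo.
Proof.
move=> u0 v0 uoo voo; rewrite ltNge leye_eq; apply/negP => /eqP uvoo.
have := lp_minkowski u0 v0.
by rewrite uvoo poweRyr ?invr_eq0 ?gt_eqF// leNgt lte_add_pinfty// poweR_lty.
Qed.

End ScalarLp.

(* The proof p1 occurs in no field: it is carried by the type because the norm
   of the canonical structures below satisfies the triangle inequality only for
   1 <= p. *)
Record lpsum (R : realType) (b : scalar_kind)
    (X : nat -> completeNormedModType (scalars R b)) (p : R) (p1 : 1 <= p) :=
  LpSum {
    lp_seq :> forall n, X n ;
    lp_finite : (\sum_(n <oo) ((rnorm (lp_seq n) `^ p)%R)%:E < +oo)%E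
  }.

Section LpSumModule.
Context {R : realType} {b : scalar_kind}
  {X : nat -> completeNormedModType (scalars R b)} {p : R} {p1 : 1 <= p}.
Implicit Types (x y z : lpsum X p1) (l : scalars R b).

Let p0 : 0 < p. Proof. exact: lt_le_trans p1. Qed.

Lemma lpsumP x y : (forall n, x n = y n) -> x = y.
Proof.
case: x y => [x hx] [y hy] /= xy.
have exy : x = y by exact: functional_extensionality_dep.
by subst y; congr LpSum; exact: Prop_irrelevance.
Qed.

HB.instance Definition _ := gen_eqMixin (lpsum X p1).
HB.instance Definition _ := gen_choiceMixin (lpsum X p1).

Lemma lp_zero_finite : (lp_sum p (fun n => (rnorm (0 : X n))%R) < +oo)%E.
Proof.
rewrite (_ : (fun n => _) = fun=> 0); first by rewrite lp_sum0.
by apply/funext => n; rewrite rnorm0.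
Qed.

Lemma lp_opp_finite x : (lp_sum p (fun n => (rnorm (- x n))%R) < +oo)%E.
Proof.
rewrite (_ : (fun n => _) = fun n => rnorm (x n)); first exact: lp_finite.
by apply/funext => n; rewrite rnormN.
Qed.

Lemma lp_add_finite x y : (lp_sum p (fun n => (rnorm (x n + y n))%R) < +oo)%E.
Proof.
apply: (@le_lt_trans _ _ (lp_sum p (fun n => rnorm (x n) + rnorm (y n))%R)).
  by apply: le_lp_sum => // n; rewrite rnorm_ge0 ler_rnormD.
by apply: lp_sumD_lty => // [n|n||]; rewrite ?rnorm_ge0//; exact: lp_finite.
Qed.

Lemma lp_scale_finite l x : (lp_sum p (fun n => (rnorm (l *: x n))%R) < +oo)%E.
Proof.
rewrite (_ : (fun n => _) = fun n => realpart `|l| * rnorm (x n)); last first.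
  by apply/funext => n; rewrite rnormZ.
rewrite lp_sumZ ?realpart_ge0// => [|n]; last exact: rnorm_ge0.
have /lp_sum_fin/fineK <- := lp_finite x.
by rewrite -EFinM ltry.
Qed.

Definition lp_zero : lpsum X p1 := LpSum p1 lp_zero_finite.
Definition lp_opp x : lpsum X p1 := LpSum p1 (lp_opp_finite x).
Definition lp_add x y : lpsum X p1 := LpSum p1 (lp_add_finite x y).
Definition lp_scale l x : lpsum X p1 := LpSum p1 (lp_scale_finite l x).

Lemma lp_addA : associative lp_add.
Proof. by move=> x y z; apply: lpsumP => n /=; rewrite addrA. Qed.
Lemma lp_addC : commutative lp_add.
Proof. by move=> x y; apply: lpsumP => n /=; rewrite addrC. Qed.
Lemma lp_add0 : left_id lp_zero lp_add.
Proof. by move=> x; apply: lpsumP => n /=; rewrite add0r. Qed.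
Lemma lp_addN : left_inverse lp_zero lp_opp lp_add.
Proof. by move=> x; apply: lpsumP => n /=; rewrite addNr. Qed.

HB.instance Definition _ :=
  GRing.isZmodule.Build (lpsum X p1) lp_addA lp_addC lp_add0 lp_addN.

Lemma lp_scaleA l l' x : lp_scale l (lp_scale l' x) = lp_scale (l * l') x.
Proof. by apply: lpsumP => n /=; rewrite scalerA. Qed.
Lemma lp_scale1 : left_id 1 lp_scale.
Proof. by move=> x; apply: lpsumP => n /=; rewrite scale1r. Qed.
Lemma lp_scaleDr : right_distributive lp_scale +%R.
Proof. by move=> l x y; apply: lpsumP => n /=; rewrite scalerDr. Qed.
Lemma lp_scaleDl x : {morph lp_scale^~ x : l l' / l + l'}.
Proof. by move=> l l'; apply: lpsumP => n /=; rewrite scalerDl. Qed.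

HB.instance Definition _ := GRing.Zmodule_isLmodule.Build (scalars R b)
  (lpsum X p1) lp_scaleA lp_scale1 lp_scaleDr lp_scaleDl.

Definition lp_rnorm x : R :=
  fine (\sum_(n <oo) ((rnorm (x n) `^ p)%R)%:E)%E `^ p^-1.

Definition lp_norm x : scalars R b := of_real (lp_rnorm x).

Lemma lp_rnormE x :
  ((lp_rnorm x)%:E = lp_sum p (fun n => rnorm (x n)) `^ p^-1)%E.
Proof.
rewrite /lp_rnorm -poweR_EFin fineK//.
by apply: lp_sum_fin; exact: lp_finite.
Qed.

Lemma lp_rnormP x (c : R) : 0 <= c ->
  (lp_sum p (fun n => rnorm (x n)) <= (c `^ p)%:E)%E -> lp_rnorm x <= c.
Proof.
move=> c0 xc; rewrite -lee_fin lp_rnormE.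
have -> : c%:E = ((c `^ p)%:E `^ p^-1)%E.
  by rewrite poweR_EFin -powRrM mulfV ?gt_eqF// powRr1.
apply: gt0_ler_poweR => //; first by rewrite invr_ge0 ltW.
  by rewrite in_itv/= lp_sum_ge0 leey.
by rewrite in_itv/= lee_fin powR_ge0 leey.
Qed.

Lemma le_rnorm_lp_rnorm x n : rnorm (x n) <= lp_rnorm x.
Proof.
rewrite -lee_fin lp_rnormE.
have -> : (rnorm (x n))%:E = ((rnorm (x n) `^ p)%:E `^ p^-1)%E.
  by rewrite poweR_EFin -powRrM mulfV ?gt_eqF// powRr1 ?rnorm_ge0.
apply: gt0_ler_poweR; first by rewrite invr_ge0 ltW.
- by rewrite in_itv/= lee_fin powR_ge0 leey.
- by rewrite in_itv/= lp_sum_ge0 leey.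
- exact: (ler_lp_sum_coord p (fun n => rnorm (x n))).
Qed.

Lemma lp_rnormD x y : lp_rnorm (x + y) <= lp_rnorm x + lp_rnorm y.
Proof.
have := @lp_minkowski R p p1 (fun n => rnorm (x n)) (fun n => rnorm (y n))
  (fun n => rnorm_ge0 (x n)) (fun n => rnorm_ge0 (y n)).
rewrite -lp_rnormE -lp_rnormE -EFinD => h.
rewrite -lee_fin lp_rnormE; apply: le_trans h.
apply: gt0_ler_poweR; first by rewrite invr_ge0 ltW.
- by rewrite in_itv/= lp_sum_ge0 leey.
- by rewrite in_itv/= lp_sum_ge0 leey.
- by apply: (le_lp_sum p1) => n; rewrite rnorm_ge0 ler_rnormD.
Qed.

Lemma lp_normD x y : lp_norm (x + y) <= lp_norm x + lp_norm y.
Proof. by rewrite /lp_norm -of_realD ler_of_real lp_rnormD. Qed.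

Lemma lp_rnormZ l x : lp_rnorm (l *: x) = realpart `|l| * lp_rnorm x.
Proof.
apply: EFin_inj; rewrite (lp_rnormE (l *: x)).
rewrite (EFinM (realpart `|l|) (lp_rnorm x)) (lp_rnormE x).
have -> : (fun n => rnorm ((l *: x) n)) =
    (fun n => realpart `|l| * rnorm (x n)).
  by apply/funext => n; exact: rnormZ.
have l0 : 0 <= realpart `|l| by exact: realpart_ge0.
rewrite (lp_sumZ p l0); last by move=> n; exact: rnorm_ge0.
rewrite poweRM ?lp_sum_ge0 ?lee_fin ?powR_ge0//.
by rewrite poweR_EFin -powRrM mulfV ?gt_eqF// powRr1.
Qed.

Lemma lp_normZ l x : lp_norm (l *: x) = `|l| * lp_norm x.
Proof.
by rewrite /lp_norm lp_rnormZ of_realM; congr (_ * _); exact: realpartK.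
Qed.

Lemma lp_norm0_eq0 x : lp_norm x = 0 -> x = 0.
Proof.
move=> /(congr1 (@realpart R b)); rewrite of_realK realpart0 => x0.
apply: lpsumP => n; apply: rnorm_eq0; apply/eqP.
by rewrite eq_le rnorm_ge0 -[X in _ <= X]x0 le_rnorm_lp_rnorm.
Qed.

HB.instance Definition _ := Lmodule_isNormed.Build (scalars R b)
  (lpsum X p1) lp_normD lp_normZ lp_norm0_eq0.

Lemma rnorm_lpE x : rnorm x = lp_rnorm x.
Proof. by rewrite /rnorm [`|x|]/(lp_norm x) of_realK. Qed.

End LpSumModule.

Section LpSumComplete.
Context {R : realType} {b : scalar_kind}
  {X : nat -> completeNormedModType (scalars R b)} {p : R} {p1 : 1 <= p}.

Let p0 : 0 < p. Proof. exact: lt_le_trans p1. Qed.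

Lemma gt0_of_real (e : R) : 0 < e -> 0 < of_real e :> scalars R b.
Proof. by rewrite -(@of_real0 R b) ltr_of_real. Qed.

Lemma realpart_gt0 (e : scalars R b) : 0 < e -> 0 < realpart e.
Proof. by move=> e0; rewrite -(@ltr_of_real R b) of_real0 realpartK// ltW. Qed.

Lemma rnorm_ball (V : normedModType (scalars R b)) (x y : V) (e : scalars R b) :
  0 < e -> ball x e y <-> rnorm (x - y) < realpart e.
Proof.
move=> e0; rewrite -ball_normE /= -(@ltr_of_real R b) rnormE.
by rewrite realpartK// ltW.
Qed.

Lemma lp_dist_limit (F : set_system (lpsum X p1)) (l : forall n, X n)
    (x : lpsum X p1) (e : R) : ProperFilter F ->
  (forall n, (fun y : lpsum X p1 => y n) @ F --> l n) -> 0 < e ->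
  F [set y | rnorm (x - y) < e] ->
  (lp_sum p (fun n => rnorm (x n - l n)%R) <= ((e + e) `^ p)%:E)%E.
Proof.
move=> FF Fl e0 Fx.
apply: lime_le.
  by apply: is_cvg_nneseries => n _ _; rewrite lee_fin powR_ge0.
near=> N.
pose u k := if (k < N)%N then rnorm (x k - l k) else 0.
pose i k : R := if (k < N)%N then 1 else 0.
have i0 k : 0 <= i k by rewrite /i; case: ifP.
have finN (w : nat -> R) : (forall k, (N <= k)%N -> w k = 0) ->
    lp_sum p w = (\sum_(0 <= k < N) ((w k `^ p)%R)%:E)%E.
  move=> w0; rewrite /lp_sum (nneseries_split 0 N); last first.
    by move=> k _; rewrite lee_fin powR_ge0.
  rewrite add0n eseries0 ?adde0// => k Nk _.
  by rewrite w0// powR0 ?gt_eqF.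
have i_fin : lp_sum p i \is a fin_num.
  rewrite finN; last by move=> k; rewrite /i ltnNge => ->.
  by apply/sum_fin_numP.
pose c := fine (lp_sum p i) `^ p^-1.
have c0 : 0 <= c by exact: powR_ge0.
pose d := e / (c + 1).
have d0 : 0 < d by rewrite divr_gt0// ltr_wpDl.
have [y [xy yl]] : exists y : lpsum X p1,
    rnorm (x - y) < e /\ forall k : 'I_N, rnorm (y k - l k) < d.
  have Fd : F [set y : lpsum X p1 | forall k : 'I_N, rnorm (y k - l k) < d].
    apply: filter_forall => k.
    have /cvg_ballP/(_ _ (gt0_of_real d0)) := Fl k.
    apply: filterS => y /rnorm_ball-/(_ (gt0_of_real d0)).
    by rewrite of_realK -rnormN opprB.
  have [y [xy yl]] := filter_ex (filterI Fx Fd).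
  by exists y.
have -> : (\sum_(0 <= k < N) ((rnorm (x k - l k) `^ p)%R)%:E)%E = lp_sum p u.
  rewrite finN; last by move=> k; rewrite /u ltnNge => ->.
  by rewrite !big_mkord; apply: eq_bigr => k _; rewrite /u ltn_ord.
have u0 k : 0 <= u k by rewrite /u; case: ifP => // _; exact: rnorm_ge0.
pose v k := rnorm (x k - y k).
have v0 k : 0 <= v k by exact: rnorm_ge0.
have w0 k : 0 <= d * i k by rewrite mulr_ge0// ltW.
have uvw : (lp_sum p u <= lp_sum p (fun k => v k + d * i k)%R)%E.
  apply: (le_lp_sum p1) => k; rewrite u0 /= /u /i.
  case: ifPn => kN; last by rewrite mulr0 addr0.
  rewrite mulr1 (_ : x k - l k = (x k - y k) + (y k - l k)); last first.
    by rewrite addrA subrK.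
  by rewrite (le_trans (ler_rnormD _ _))// lerD2l ltW// (yl (Ordinal kN)).
have mink := lp_minkowski p1 v0 w0.
have root z : (0 <= z -> (z `^ p^-1) `^ p = z)%E.
  by move=> z0; rewrite -poweRrM mulVf ?gt_eqF// poweRe1.
have vE : (lp_sum p v `^ p^-1 <= e%:E)%E.
  rewrite -(lp_rnormE (x - y)) lee_fin ltW//.
  by move: xy; rewrite rnorm_lpE.
have wE : (lp_sum p (fun k => d * i k)%R `^ p^-1 <= e%:E)%E.
  rewrite (lp_sumZ p (ltW d0) i0) poweRM ?lp_sum_ge0 ?lee_fin ?powR_ge0//.
  rewrite poweR_EFin -powRrM mulfV ?gt_eqF// powRr1 ?(ltW d0)//.
  rewrite -(fineK i_fin) poweR_EFin -EFinM lee_fin -/c /d.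
  rewrite -mulrA mulrC -ler_pdivlMr// divff ?gt_eqF//.
  by rewrite mulrC ler_pdivrMr ?ltr_wpDl// mul1r lerDl.
apply: (le_trans uvw); rewrite -(root _ (lp_sum_ge0 _ _)) -poweR_EFin.
apply: gt0_ler_poweR; first exact: ltW.
- by rewrite in_itv/= poweR_ge0 leey.
- by rewrite in_itv/= lee_fin addr_ge0 ?(ltW e0)// leey.
- by rewrite (le_trans mink)// EFinD leeD.
Unshelve. all: by end_near. Qed.

Let quarter_lt (r s t : R) :
  0 < r / 4 -> s < r / 4 -> t <= r / 4 + r / 4 -> s + t < r.
Proof. by move=> r0 sr tr; lra. Qed.

Lemma lp_complete (F : set_system (lpsum X p1)) :
  ProperFilter F -> cauchy F -> cvg F.
Proof.
move=> FF Fc.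
have Fe (e : R) : 0 < e -> exists x, F [set y | rnorm (x - y) < e].
  move=> e0; move/cauchyP : Fc => /(_ _ (gt0_of_real e0)) [x Fx].
  exists x; apply: filterS Fx => y /rnorm_ball-/(_ (gt0_of_real e0)).
  by rewrite of_realK.
have Fn n : cvg ((fun x : lpsum X p1 => x n) @ F).
  apply: cauchy_cvg; apply: cauchy_exP => e e0.
  have [x Fx] := Fe _ (realpart_gt0 e0); exists (x n).
  suff sub : [set y | rnorm (x - y) < realpart e] `<=`
      (fun y : lpsum X p1 => y n) @^-1` ball (x n) e by exact: filterS sub Fx.
  move=> y /= xy; apply/rnorm_ball => //; apply: le_lt_trans xy.
  rewrite rnorm_lpE; exact: (le_rnorm_lp_rnorm (x - y) n).
pose l n : X n := lim ((fun x : lpsum X p1 => x n) @ F).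
have Fl n : (fun y : lpsum X p1 => y n) @ F --> l n by exact: Fn.
have key x e := @lp_dist_limit F l x e FF Fl.
have l_fin : (lp_sum p (fun n => rnorm (l n)) < +oo)%E.
  have [x Fx] := Fe 1 ltr01.
  have := key x 1 ltr01 Fx => xl.
  apply: (@le_lt_trans _ _
    (lp_sum p (fun n => rnorm (x n) + rnorm (x n - l n))%R)).
    apply: (le_lp_sum p1) => n; rewrite rnorm_ge0 /= -(rnormN (x n - l n)).
    by rewrite (le_trans _ (ler_rnormD _ _))// opprB addrCA subrr addr0.
  apply: (lp_sumD_lty p1) => [n|n||]; rewrite ?rnorm_ge0//.
    exact: lp_finite.
  by rewrite (le_lt_trans xl)// ltry.
pose L := LpSum p1 l_fin.
apply/cvg_ex; exists L; apply/cvg_ballP => e e0.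
have e40 : 0 < realpart e / 4 by rewrite divr_gt0// realpart_gt0.
have [x Fx] := Fe _ e40.
apply: filterS (Fx) => y /= xy; apply/rnorm_ball => //.
have xL : rnorm (x - L) <= realpart e / 4 + realpart e / 4.
  rewrite rnorm_lpE; apply: lp_rnormP; first by rewrite addr_ge0 ?(ltW e40).
  exact: (key x _ e40 Fx).
rewrite (_ : L - y = (x - y) - (x - L)); last by rewrite opprB [RHS]addrC addrA subrK.
rewrite (le_lt_trans (ler_rnormD _ _))// rnormN.
exact: quarter_lt xL.
Qed.

HB.instance Definition _ := Uniform_isComplete.Build (lpsum X p1) lp_complete.

End LpSumComplete.

Section SlicelyCountablyDetermined.
Context {R : realType} {b : scalar_kind} {V : normedModType (scalars R b)}.
Implicit Types (A B H S : set V) (a : V).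

Definition closed_unit_ball : set V := [set x | `|x| <= 1].

Definition open_half_space H := exists (f : {linear V -> (scalars R b)^o}) (c : R),
  [/\ continuous f, exists x, f x != 0 & H = [set x | c < realpart (f x)]].

Definition slice A S :=
  S !=set0 /\ exists2 H, open_half_space H & S = A `&` H.

(* convex_set only involves weights t : K with 0 <= t <= 1; in the order of
   R[i] these are the real numbers of [0, 1], so the hull below is the usual
   one for both scalar fields. *)
Definition conv_hull A : set V := smallest (@convex_set (scalars R b) V) A.

Definition determining A a (S : nat -> set V) :=
  (forall n, S n `<=` A /\ S n !=set0) /\
  forall B, B `<=` A -> (forall n, B `&` S n !=set0) ->
    closure (conv_hull B) a.

Definition SCD A : set V :=
  [set a | A a /\
    exists S : nat -> set V, (forall n, slice A (S n)) /\ determining A a S].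

End SlicelyCountablyDetermined.
Arguments closed_unit_ball {R b} V.

(* Main.v *)
From HB Require Import structures.
Require Import Defs.
From mathcomp Require Import all_boot all_order all_algebra.
From mathcomp Require Import complex ring lra.
From mathcomp Require Import all_classical all_reals all_analysis.
Import Order.TTheory GRing.Theory Num.Theory.
Import numFieldNormedType.Exports.
Local Open Scope classical_set_scope.
Local Open Scope ring_scope.

(** Let B be the unit ball of X_p. For each n take a unit vector u_n of X_n and
    a norm-one functional f_n with f_n(u_n) = 1, and let S_n be the slice of
    those y in B with Re f_n(y_n) > c_n, where c_n^p = 1 - d_n^p and
    d_n = 2^-(n+1). It contains u_n placed in coordinate n. As
    Re f_n(y_n) <= |y_n|, a point y of S_n carries almost all of its norm in
    the coordinate n: the p-th powers of the norms of the coordinates add up to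
    at most 1, so what remains of y off that coordinate has norm at most d_n
    ([rnorm_off_diagonal_le]).

    Suppose that a subset of B contains a point y_n of every S_n. In the sum
    of y_0, ..., y_(N-1), the coordinates n of the y_n are disjointly supported
    and give a vector of norm at most N^(1/p) ([rnorm_diagonal_le]), while the
    remainders have total norm at most the sum of the d_n, hence at most 1.
    The average of the y_n is in the convex hull and has norm at most
    (N^(1/p) + 1) / N, which is small for large N because p > 1; this is
    [closure_conv_hull0].

    The functionals f_n come from the Hahn-Banach theorem. It is proved for a
    sublinear functional q on a real vector space through minimality: by Zorn's
    lemma there is a minimal sublinear functional below q, and such a
    functional is linear. This avoids partially defined functionals. The
    complex case follows as usual, a real-linear g being the real part of the
    complex-linear functional x |-> g x - i g (i x). *)

(** * Hahn-Banach theorem for sublinear functionals *)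

(** Homogeneity is only asked as an inequality: applied to r and to its inverse
    it gives the equality, and it is the inequality that passes to infima. *)
Definition sublinear {R : realType} {V : lmodType R} (q : V -> R) :=
  (forall x y, q (x + y) <= q x + q y) /\
  (forall r x, 0 < r -> q (r *: x) <= r * q x).

Section Sublinear.
Context {R : realType} {V : lmodType R}.
Implicit Types (q g : V -> R) (x y : V).

Lemma sublinearZ q (r : R) x : sublinear q -> 0 <= r -> q (r *: x) = r * q x.
Proof.
move=> [qD qZ]; rewrite le_eqVlt => /predU1P[<-|r0]; last first.
  apply/eqP; rewrite eq_le qZ//= -ler_pdivlMl//.
  rewrite -{1}[x]scale1r -(mulVf (lt0r_neq0 r0)) -scalerA.
  by rewrite qZ ?invr_gt0.
rewrite scale0r mul0r; have := qD 0 0; have := qZ 2^-1 0.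
rewrite scaler0 addr0 invr_gt0 ltr0n => /(_ isT).
by move=> h1 h2; apply/eqP; rewrite eq_le; apply/andP; split; lra.
Qed.

Lemma sublinear0 q : sublinear q -> q 0 = 0.
Proof. by move=> qs; rewrite -(scale0r 0) sublinearZ// mul0r. Qed.

Lemma sublinear_ge q x : sublinear q -> - q (- x) <= q x.
Proof.
move=> qs; rewrite -subr_ge0 opprK -(sublinear0 q qs) -(subrr x).
exact: qs.1.
Qed.

(** For a sublinear q, the largest sublinear functional below q whose value at
    - y is at most - q y. Lowering q in this way serves twice: it shows that a
    minimal q is linear, and it forces the value of the extension at a given
    vector. *)
Definition tilt q y x : R :=
  inf [set q (x + t *: y) - t * q y | t in [set t : R | 0 <= t]].

Section Tilt.
Context {q : V -> R} (qs : sublinear q).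

Lemma tilt_le y x (t : R) : 0 <= t -> tilt q y x <= q (x + t *: y) - t * q y.
Proof.
move=> t0; apply: ge_inf; last by exists t.
(* Subadditivity at s y = (x + s y) + (- x) bounds the set below by - q (- x),
   so that its infimum is a genuine one. *)
exists (- q (- x)) => _ [s /= s0 <-].
rewrite -sublinearZ// lerBrDl lerBlDr addrC.
by rewrite -{1}[s *: y](addKr x); exact: qs.1.
Qed.

Lemma le_tilt y x (c : R) :
  (forall t, 0 <= t -> c <= q (x + t *: y) - t * q y) -> c <= tilt q y x.
Proof.
move=> h; apply: lb_le_inf; last by move=> _ [t /= t0 <-]; exact: h.
by exists (q (x + 0 *: y) - 0 * q y); exists 0 => /=.
Qed.

Lemma tilt_le_self y x : tilt q y x <= q x.
Proof.
by have := tilt_le y x 0 (lexx 0); rewrite scale0r mul0r addr0 subr0.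
Qed.

Lemma tilt_opp y : tilt q y (- y) <= - q y.
Proof.
have := tilt_le y (- y) 1 ler01.
by rewrite scale1r mul1r addNr sublinear0// sub0r.
Qed.

Lemma tilt_sublinear y : sublinear (tilt q y).
Proof.
split=> [x z|r x r0].
- rewrite -lerBlDr; apply: le_tilt => s s0; rewrite lerBlDr -lerBlDl.
  apply: le_tilt => t t0; rewrite lerBlDl.
  apply: (le_trans (tilt_le y _ _ (addr_ge0 s0 t0))).
  rewrite scalerDl addrACA mulrDl opprD.
  have := qs.1 (x + s *: y) (z + t *: y); lra.
- rewrite -ler_pdivrMl//; apply: le_tilt => t t0; rewrite ler_pdivrMl//.
  apply: (le_trans (tilt_le y _ _ (mulr_ge0 (ltW r0) t0))).
  by rewrite -scalerA -scalerDr (sublinearZ q _ _ qs (ltW r0)) mulrBr mulrA.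
Qed.

End Tilt.

(** Totality of the order on A is what makes the infimum subadditive: of two
    members of A, one is below the other and can be used at both points. The
    common bound q makes the infimum finite: g x >= - g (- x) >= - q (- x). *)
Lemma chain_inf_sublinear (A : set (V -> R)) q :
  A !=set0 -> (forall g, A g -> sublinear g /\ forall x, g x <= q x) ->
  (forall g h, A g -> A h ->
    (forall x, g x <= h x) \/ (forall x, h x <= g x)) ->
  exists m, sublinear m /\ forall g, A g -> forall x, m x <= g x.
Proof.
move=> [g0 Ag0] As Atot.
pose m x := inf [set g x | g in A].
have mle g x : A g -> m x <= g x.
  move=> Ag; apply: ge_inf; last by exists g.
  exists (- q (- x)) => _ [h Ah <-].
  apply: le_trans (sublinear_ge h x (As h Ah).1).
  by rewrite lerN2; exact: (As h Ah).2.
have lem x c : (forall g, A g -> c <= g x) -> c <= m x.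
  move=> h; apply: lb_le_inf; last by move=> _ [g Ag <-]; exact: h.
  by exists (g0 x); exists g0.
exists m; split=> [|g Ag x]; last exact: mle.
split=> [x y|r x r0].
- rewrite -lerBlDr; apply: (lem x) => g Ag; rewrite lerBlDr -lerBlDl.
  apply: (lem y) => h Ah; rewrite lerBlDl.
  have [gh|hg] := Atot g h Ag Ah.
  + apply: (le_trans (mle g _ Ag)).
    by rewrite (le_trans ((As g Ag).1.1 x y))// lerD2l.
  + apply: (le_trans (mle h _ Ah)).
    by rewrite (le_trans ((As h Ah).1.1 x y))// lerD2r.
- rewrite -ler_pdivrMl//; apply: (lem x) => g Ag; rewrite ler_pdivrMl//.
  by rewrite (le_trans (mle g _ Ag))//; exact: (As g Ag).1.2.
Qed.

Lemma exists_minimal_sublinear q : sublinear q ->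
  exists g, [/\ sublinear g, forall x, g x <= q x &
    forall h, sublinear h -> (forall x, h x <= g x) -> forall x, g x <= h x].
Proof.
move=> qs.
pose T := {g : V -> R | sublinear g /\ forall x, g x <= q x}.
pose le (g h : T) := `[< forall x, sval h x <= sval g x >].
have [||A Atot|[g [gs gq]] gmin] :=
  @ZL_preorder T (exist _ q (conj qs (fun x => lexx (q x)))) le.
- by move=> g; apply/asboolP.
- move=> g h k /asboolP gh /asboolP hk; apply/asboolP => x.
  exact: le_trans (gh x).
- have [->|/set0P[g0 Ag0]] := eqVneq A set0.
    by exists (exist _ q (conj qs (fun x => lexx (q x)))).
  have [|||m [ms mA]] := @chain_inf_sublinear (sval @` A) q.
  + by exists (sval g0); exists g0.
  + by move=> _ [k Ak <-]; exact: (svalP k).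
  + move=> _ _ [k Ak <-] [l Al <-].
    by have [/asboolP|/asboolP] := Atot k l Ak Al; [right|left].
  have mq x : m x <= q x.
    exact: le_trans (mA _ (imageP sval Ag0) x) ((svalP g0).2 x).
  exists (exist _ m (conj ms mq)) => k Ak.
  by apply/asboolP => x; exact: mA (imageP sval Ak) x.
- exists g; split=> // h hs hg.
  have hT : sublinear h /\ forall x, h x <= q x.
    by split=> // x; exact: le_trans (gq x).
  by apply/asboolP; apply: (gmin (exist _ h hT)); exact/asboolP.
Qed.

(** Minimality gives g <= tilt g y, and the term t = 1 of the infimum reads
    g x + g y <= g (x + y). *)
Lemma minimal_sublinear_linear g : sublinear g ->
    (forall h, sublinear h -> (forall x, h x <= g x) -> forall x, g x <= h x) ->
  linear_for *%R g.
Proof.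
move=> gs gmin.
have gD x y : g (x + y) = g x + g y.
  apply/eqP; rewrite eq_le gs.1/= -lerBrDr.
  apply: (le_trans (gmin _ (tilt_sublinear gs y) (tilt_le_self gs y) x)).
  by have := tilt_le gs y x 1 ler01; rewrite scale1r mul1r.
have gN x : g (- x) = - g x.
  by apply/eqP; rewrite -addr_eq0 -gD addNr sublinear0.
move=> r x y; rewrite gD; congr (_ + _).
have [r0|/ltW r0] := leP 0 r; first exact: sublinearZ.
by rewrite -[r]opprK scaleNr gN (sublinearZ g) ?oppr_ge0// !mulNr.
Qed.

(** Any minimal sublinear functional below tilt q x0 will do: its value at - x0
    is at most - q x0, hence by linearity its value at x0 is at least q x0. *)
Theorem hahn_banach_sublinear q x0 : sublinear q ->
  exists g : {linear V -> R^o}, (forall x, g x <= q x) /\ g x0 = q x0.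
Proof.
move=> qs.
have [g [gs gq gmin]] :=
  exists_minimal_sublinear (tilt q x0) (tilt_sublinear qs x0).
have glin := minimal_sublinear_linear g gs gmin.
pose G : {linear V -> R^o} :=
  HB.pack (g : V -> R^o) (GRing.isLinear.Build R V R^o *%R g glin).
have Gq x : G x <= q x by exact: le_trans (gq x) (tilt_le_self qs x0 x).
exists G; split=> //; apply/eqP; rewrite eq_le Gq/=.
have GN : G (- x0) = - G x0 by exact: linearN.
by rewrite -lerN2 -GN (le_trans (gq _))// tilt_opp.
Qed.

End Sublinear.

(** * Norming functionals over both scalar fields *)

(** The same vectors under a new name, so that the multiplication by real
    scalars does not clash with the one by scalars of the given field. *)
Definition real_restriction {R : realType} {b : scalar_kind}
  (V : lmodType (scalars R b)) : Type := V.

Section RealRestriction.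
Context {R : realType} {b : scalar_kind} {V : lmodType (scalars R b)}.
Local Notation VR := (real_restriction V).

HB.instance Definition _ := GRing.Zmodule.on VR.

Definition restricted_scale (r : R) (x : VR) : VR :=
  (of_real r : scalars R b) *: (x : V).

Lemma of_real1 : of_real 1 = 1 :> scalars R b.
Proof. by case: b. Qed.

Lemma restricted_scaleA r s x :
  restricted_scale r (restricted_scale s x) = restricted_scale (r * s) x.
Proof. by rewrite /restricted_scale scalerA -of_realM. Qed.

Lemma restricted_scale1 : left_id 1 restricted_scale.
Proof. by move=> x; rewrite /restricted_scale of_real1 scale1r. Qed.

Lemma restricted_scaleDr : right_distributive restricted_scale +%R.
Proof. by move=> r x y; rewrite /restricted_scale scalerDr. Qed.

Lemma restricted_scaleDl x : {morph restricted_scale^~ x : r s / r + s}.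
Proof. by move=> r s; rewrite /restricted_scale of_realD scalerDl. Qed.

HB.instance Definition _ := GRing.Zmodule_isLmodule.Build R VR
  restricted_scaleA restricted_scale1 restricted_scaleDr restricted_scaleDl.

End RealRestriction.

(** Over C, f x = g x - i g (i x); over R, f = g. *)
Lemma exists_complexification {R : realType} {b : scalar_kind}
    {V : lmodType (scalars R b)} (g : {linear real_restriction V -> R^o}) :
  exists f : {linear V -> (scalars R b)^o}, forall x, realpart (f x) = g x.
Proof.
case: b V g => V g.
- have flin : linear_for *%R (g : V -> R).
    by move=> r x y; exact: (linearP g r x y).
  pose G : {linear V -> R^o} :=
    HB.pack (g : V -> R^o) (GRing.isLinear.Build R V R^o *%R (g : V -> R) flin).
  by exists G.
pose f (x : V) : R[i] := Complex (g x) (- g ('i%C *: x : V)).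
have gD x y : g ((x : V) + y) = g x + g y by exact: (linearD g x y).
have gZ (r : R) (x : V) : g ((r%:C)%C *: x : V) = r * g x.
  by exact: (linearZZ g r x).
have flin : linear_for *%R f.
  move=> [r s] x y.
  have E : Complex r s = (r%:C)%C + (s%:C)%C * 'i%C.
    by apply/eqP; rewrite eq_complex /=; apply/andP; split; apply/eqP; ring.
  have E2 : 'i%C * Complex r s = (r%:C)%C * 'i%C + ((- s)%:C)%C :> R[i].
    by apply/eqP; rewrite eq_complex /=; apply/andP; split; apply/eqP; ring.
  rewrite /f !scalerDr !gD.
  rewrite scalerA E2 E !scalerDl !gD -!scalerA !gZ.
  by apply/eqP; rewrite eq_complex /=; apply/andP; split; apply/eqP; ring.
pose F : {linear V -> R[i]^o} :=
  HB.pack (f : V -> R[i]^o) (GRing.isLinear.Build R[i] V R[i]^o *%R f flin).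
by exists F.
Qed.

Lemma exists_norming_functional {R : realType} {b : scalar_kind}
    {V : normedModType (scalars R b)} (x0 : V) :
  exists f : {linear V -> (scalars R b)^o},
    [/\ forall x, `|f x| <= `|x|, forall x, realpart (f x) <= rnorm x &
        realpart (f x0) = rnorm x0].
Proof.
have ns : sublinear (fun x : real_restriction V => rnorm (x : V)).
  split=> [x y|r x r0]; first exact: ler_rnormD.
  rewrite /= [r *: x]/(restricted_scale r x) /restricted_scale rnormZ ger0_norm.
    by rewrite of_realK.
  by rewrite -of_real0 ler_of_real ltW.
have [g [gle gx0]] := hahn_banach_sublinear _ (x0 : real_restriction V) ns.
have [f fg] := exists_complexification g.
exists f; split=> [x|x|]; [|by rewrite fg gle|by rewrite fg gx0].
have [->|fx0] := eqVneq (f x) 0; first by rewrite normr0.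
(* The bound on the real part passes to the modulus: multiplying x by the scalar
   u of modulus one makes f (u x) real, equal to the modulus of f x. *)
pose u : scalars R b := `|f x| / f x.
have fux : f (u *: x) = `|f x|.
  have -> : f (u *: x) = u * f x by exact: linearZZ.
  by rewrite /u divfK.
have u1 : `|u| = 1 by rewrite normrM normfV normr_id divff// normr_eq0.
have := gle (u *: x); rewrite -fg fux /= => h.
rewrite -(realpartK (normr_ge0 (f x))) -(rnormE x) ler_of_real.
by rewrite (le_trans h)// rnormZ u1 -of_real1 of_realK mul1r.
Qed.

Lemma contractive_continuous {R : realType} {b : scalar_kind}
    {V : normedModType (scalars R b)} (f : {linear V -> (scalars R b)^o}) :
  (forall x, `|f x| <= `|x|) -> continuous f.
Proof.
move=> fle; apply: bounded_linear_continuous; apply/linear_boundedP.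
near=> r => x; rewrite (le_trans (fle x))// ler_peMl//.
Unshelve. all: by end_near. Qed.

Section RealNorms.
Context {R : realType} {b : scalar_kind}.

Lemma ler_rnorm (V W : normedModType (scalars R b)) (v : V) (w : W) :
  (`|v| <= `|w|) = (rnorm v <= rnorm w).
Proof. by rewrite -(rnormE v) -(rnormE w) ler_of_real. Qed.

Lemma closed_unit_ballE (V : normedModType (scalars R b)) :
  closed_unit_ball V = [set x | rnorm x <= 1].
Proof.
apply/funext => x; rewrite /closed_unit_ball /= -rnormE.
by rewrite -(@of_real1 R b) ler_of_real.
Qed.

Lemma exists_unit_vector (V : normedModType (scalars R b)) :
  (exists x : V, x != 0) -> exists u : V, rnorm u = 1.
Proof.
move=> [x x0]; exists (`|x|^-1 *: x).
rewrite /rnorm normrZ normfV normr_id mulVf ?normr_eq0//.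
by rewrite -of_real1 of_realK.
Qed.

Lemma realpart_normV n : realpart `|n.+1%:R^-1 : scalars R b| = n.+1%:R^-1 :> R.
Proof.
have -> : n.+1%:R^-1 = of_real n.+1%:R^-1 :> scalars R b.
  case: b => //=.
  by rewrite -[RHS]/((n.+1%:R^-1)%:C)%C fmorphV rmorph_nat.
rewrite ger0_norm ?of_realK// -(@of_real0 R b) ler_of_real invr_ge0.
exact: ler0n.
Qed.

End RealNorms.

(** * Averages and convex hulls *)

(** The average of N + 2 vectors is the convex combination of the last one, with
    weight 1 / (N + 2), and of the average of the others. *)
Lemma convex_set_average {K : numFieldType} {V : lmodType K} (A : set V)
    (y : nat -> V) N : @convex_set K V A -> (forall n, A (y n)) ->
  A (N.+1%:R^-1 *: \sum_(n < N.+1) y n).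
Proof.
move=> Acvx Ay; elim: N => [|N IH]; first by rewrite big_ord1 invr1 scale1r.
have t0 : 0 <= N.+2%:R^-1 :> K by rewrite invr_ge0.
have t1 : N.+2%:R^-1 <= 1 :> K by rewrite invf_le1 ?ler1n.
have := Acvx _ _ (Itv01 t0 t1) (mem_set (Ay N.+1)) (mem_set IH).
rewrite inE; congr (A _).
rewrite [LHS]/(N.+2%:R^-1 *: y N.+1 + (1 - N.+2%:R^-1) *: _).
rewrite [in RHS]big_ord_recr/= addrC scalerDr.
congr (_ + _); rewrite scalerA; congr (_ *: _).
have weights : (1 - (N.+1%:R + 1)^-1) / N.+1%:R = (N.+1%:R + 1)^-1 :> K.
  have : N.+1%:R + 1 != 0 :> K by rewrite natr1 pnatr_eq0.
  have : N.+1%:R != 0 :> K by rewrite pnatr_eq0.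
  by move: N.+1%:R => s s0 s10; field; rewrite s0 s10.
rewrite -[N.+2]addn1 natrD.
exact: weights.
Qed.

Lemma closure_rnorm {R : realType} {b : scalar_kind}
    {V : normedModType (scalars R b)}
    (A : set V) (a : V) :
  (forall e, 0 < e -> exists z, A z /\ rnorm (a - z) < e) -> closure A a.
Proof.
move=> h B /nbhs_ballP[e /= e0 eB].
have [z [Az ze]] := h _ (realpart_gt0 e0).
by exists z; split=> //; apply: eB; apply/rnorm_ball.
Qed.

Lemma ler_rnorm_sum {R : realType} {b : scalar_kind}
    {V : normedModType (scalars R b)} N (y : 'I_N -> V) :
  rnorm (\sum_n y n) <= \sum_n rnorm (y n).
Proof.
elim/big_ind2 : _ => [|u r v s ur vs|//]; first by rewrite rnorm0.
by rewrite (le_trans (ler_rnormD _ _))// lerD.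
Qed.

(** * Numerical estimates *)

Lemma one_powR {R : realType} (x : R) : 1 `^ x = 1 :> R.
Proof. by rewrite powR1. Qed.

Lemma sum_half_pow_le1 {R : realType} N : \sum_(n < N) 2^-1 ^+ n.+1 <= 1 :> R.
Proof.
suff -> : \sum_(n < N) 2^-1 ^+ n.+1 = 1 - 2^-1 ^+ N :> R.
  by rewrite gerBl exprn_ge0.
elim: N => [|N IH]; first by rewrite big_ord0 expr0 subrr.
by rewrite big_ord_recr/= IH exprS; lra.
Qed.

(** With a = 1 - 1/p > 0 and m = N + 1, the quantity is at most 2 m^(1/p) / m,
    that is 2 / m^a; so it suffices that m exceeds (2 / e)^(1/a). *)
Lemma exists_powR_average_lt {R : realType} (p e : R) : 1 < p -> 0 < e ->
  exists N, N.+1%:R^-1 * (N.+1%:R `^ p^-1 + 1) < e.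
Proof.
move=> p1 e0; have p0 : 0 < p by exact: lt_trans p1.
pose a := 1 - p^-1.
have a0 : 0 < a by rewrite subr_gt0 invf_lt1.
pose M := (2 / e) `^ a^-1.
pose N := Num.bound M; exists N.
have MN : M < N.+1%:R.
  by rewrite (lt_trans (archi_boundP (powR_ge0 _ _)))// ltr_nat.
have N0 : 0 < N.+1%:R :> R by [].
have h1 : 2 / e < N.+1%:R `^ a.
  have -> : 2 / e = M `^ a.
    by rewrite /M -powRrM mulVf ?gt_eqF// powRr1// divr_ge0// ltW.
  by rewrite gt0_ltr_powR// nnegrE ?powR_ge0.
have h2 : N.+1%:R = N.+1%:R `^ a * N.+1%:R `^ p^-1.
  by rewrite -powRD ?subrK ?powRr1// pnatr_eq0/= implybT.
have h3 : 1 <= N.+1%:R `^ p^-1.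
  rewrite -[X in X <= _](powRr0 N.+1%:R) ler_powR ?ler1n// invr_ge0.
  exact: ltW.
rewrite mulrC ltr_pdivrMr// [X in e * X]h2.
move: h1 h3; rewrite ltr_pdivrMr//.
move: (N.+1%:R `^ a) (N.+1%:R `^ p^-1) => u v h1 h3.
nra.
Qed.

(** * Coordinates in an l_p-sum *)

Section LpCoordinates.
Context {R : realType} {b : scalar_kind}
  {X : nat -> completeNormedModType (scalars R b)} {p : R} {p1 : 1 <= p}.
Implicit Types x y : lpsum X p1.

Let p0 : 0 < p. Proof. exact: lt_le_trans p1. Qed.

Lemma lp_mask_finite (P : pred nat) x :
  (lp_sum p (fun n => rnorm (if P n then x n else 0)%R) < +oo)%E.
Proof.
apply: le_lt_trans (lp_finite x); apply: (le_lp_sum p1) => n.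
by rewrite rnorm_ge0/=; case: ifP => // _; rewrite rnorm0 rnorm_ge0.
Qed.

Definition lp_mask (P : pred nat) x : lpsum X p1 :=
  LpSum p1 (lp_mask_finite P x).

Lemma lp_mask_predC (P : pred nat) x : x = lp_mask P x + lp_mask (predC P) x.
Proof.
by apply: lpsumP => n /=; case: (P n); rewrite /= ?addr0 ?add0r.
Qed.

Lemma lp_sum_finite_support (u : nat -> R) N :
  (forall k, (N <= k)%N -> u k = 0) ->
  lp_sum p u = (\sum_(0 <= k < N) (u k `^ p)%:E)%E.
Proof.
move=> u0; rewrite /lp_sum (nneseries_split 0 N); last first.
  by move=> k _; rewrite lee_fin powR_ge0.
rewrite add0n eseries0 ?adde0// => k Nk _.
by rewrite u0// powR0 ?gt_eqF.
Qed.

Lemma lp_single_finite (x : forall n, X n) n :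
  (lp_sum p (fun k => rnorm (if k == n then x k else 0)%R) < +oo)%E.
Proof.
rewrite (@lp_sum_finite_support _ n.+1) => [|k nk]; last first.
  by rewrite gtn_eqF// rnorm0.
by rewrite sumEFin ltry.
Qed.

(** Starting from a whole family x rather than from a vector of X n avoids a
    transport along the equality k = n between the types X n and X k. *)
Definition lp_single (x : forall n, X n) n : lpsum X p1 :=
  LpSum p1 (lp_single_finite x n).

Lemma rnorm_lp_single_le (x : forall n, X n) n :
  rnorm (lp_single x n) <= rnorm (x n).
Proof.
rewrite rnorm_lpE; apply: lp_rnormP; first exact: rnorm_ge0.
rewrite (@lp_sum_finite_support _ n.+1) => [|k nk]; last first.
  by rewrite /= gtn_eqF// rnorm0.
rewrite sumEFin lee_fin big_nat_recr//= eqxx big_nat big1 ?add0r// => k.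
by move=> /andP[_ kn]; rewrite ltn_eqF// rnorm0 powR0// gt_eqF.
Qed.

Lemma lp_mask_sum_seq N (y : nat -> lpsum X p1) k :
  (\sum_(n < N) lp_mask (pred1 (n : nat)) (y n)) k =
  if (k < N)%N then y k k else 0.
Proof.
rewrite (big_morph (fun x : lpsum X p1 => x k) (id1 := 0) (op1 := +%R))//=.
case: ifPn => [kN|]; last first.
  rewrite -leqNgt => Nk; rewrite big1// => i _.
  by rewrite gtn_eqF// (leq_trans _ Nk).
rewrite (bigD1 (Ordinal kN))//= eqxx big1 ?addr0// => i ik.
by rewrite ifN// eq_sym.
Qed.

(** The summands have disjoint supports, so the p-th powers of their norms, each
    at most 1, add up. *)
Lemma rnorm_diagonal_le N (y : nat -> lpsum X p1) :
  (forall n, rnorm (y n) <= 1) ->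
  rnorm (\sum_(n < N) lp_mask (pred1 (n : nat)) (y n)) <= N%:R `^ p^-1.
Proof.
move=> y1; rewrite rnorm_lpE; apply: lp_rnormP; first exact: powR_ge0.
rewrite -powRrM mulVf ?gt_eqF// powRr1//.
rewrite (@lp_sum_finite_support _ N); last first.
  by move=> k Nk; rewrite lp_mask_sum_seq ltnNge Nk/= rnorm0.
rewrite sumEFin lee_fin -[N in X in _ <= X]subn0 -sumr_const_nat !big_nat.
apply: ler_sum => k /andP[_ kN]; rewrite lp_mask_sum_seq kN.
rewrite -[leRHS](one_powR p) ge0_ler_powR ?nnegrE ?rnorm_ge0 ?(ltW p0)//.
by rewrite (le_trans (le_rnorm_lp_rnorm (y k) k))// -rnorm_lpE.
Qed.

(** The p-th powers of the norms of all coordinates add up to at most 1, and the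
    coordinate n takes at least 1 - d^p of this. *)
Lemma rnorm_off_diagonal_le (y : lpsum X p1) n (d : R) : 0 <= d -> d <= 1 ->
  rnorm y <= 1 -> (1 - d `^ p) `^ p^-1 <= rnorm (y n) ->
  rnorm (lp_mask (predC1 n) y) <= d.
Proof.
move=> d0 d1 y1 yn; rewrite rnorm_lpE; apply: lp_rnormP => //.
have root z : (0 <= z -> (z `^ p^-1) `^ p = z)%R.
  by move=> z0; rewrite -powRrM mulVf ?gt_eqF// powRr1.
have dp1 : 0 <= 1 - d `^ p.
  by rewrite subr_ge0 -[leRHS](one_powR p) ge0_ler_powR ?nnegrE ?(ltW p0).
have ynp : 1 - d `^ p <= rnorm (y n) `^ p.
  rewrite -[X in X <= _](root _ dp1).
  by rewrite ge0_ler_powR ?nnegrE ?powR_ge0 ?rnorm_ge0 ?(ltW p0).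
have ysum : (lp_sum p (fun k => rnorm (y k)) <= 1)%E.
  have yfin : lp_sum p (fun k => rnorm (y k)) \is a fin_num.
    by apply: lp_sum_fin; exact: lp_finite.
  have s0 : 0 <= fine (lp_sum p (fun k => rnorm (y k))).
    by rewrite fine_ge0// lp_sum_ge0.
  rewrite -(fineK yfin) lee_fin -[X in X <= _](root _ s0).
  rewrite -[leRHS](one_powR p) ge0_ler_powR ?nnegrE ?powR_ge0 ?(ltW p0)//.
  by move: y1; rewrite rnorm_lpE.
have split_n : lp_sum p (fun k => rnorm (y k)) =
    ((rnorm (y n) `^ p)%:E +
     lp_sum p (fun k => rnorm (lp_mask (predC1 n) y k)))%E.
  rewrite /lp_sum (nneseriesD1 (n := n))//; last first.
    by move=> k _; rewrite lee_fin powR_ge0.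
  congr (_ + _)%E; rewrite eseries_mkcond; apply: eq_eseriesr => k _ /=.
  by case: ifP => //; rewrite rnorm0 powR0// gt_eqF.
have mfin : lp_sum p (fun k => rnorm (lp_mask (predC1 n) y k)) \is a fin_num.
  by apply: lp_sum_fin; exact: lp_finite.
move: ysum; rewrite split_n -(fineK mfin) -EFinD !lee_fin; lra.
Qed.

End LpCoordinates.

(** * The determining slices *)

Section LpBall.
Context {R : realType} {b : scalar_kind}.

Lemma exists_coordinate_functional
    {X : nat -> completeNormedModType (scalars R b)}
    {p : R} (p1 : 1 <= p) n (f : {linear X n -> (scalars R b)^o}) :
  exists F : {linear lpsum X p1 -> (scalars R b)^o}, forall y, F y = f (y n).
Proof.
have Flin : linear_for *%R (fun y : lpsum X p1 => f (y n)).
  by move=> r y z; exact: (linearP f r (y n) (z n)).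
pose F : {linear lpsum X p1 -> (scalars R b)^o} :=
  HB.pack ((fun y => f (y n)) : lpsum X p1 -> (scalars R b)^o)
    (GRing.isLinear.Build (scalars R b) (lpsum X p1) (scalars R b)^o *%R
      (fun y : lpsum X p1 => f (y n)) Flin).
by exists F.
Qed.

(** The y n may be any points of the ball that concentrate on distinct
    coordinates; the slices enter only through this property. *)
Lemma closure_conv_hull0 {X : nat -> completeNormedModType (scalars R b)}
    {p : R} (p_gt1 : 1 < p) (B : set (lpsum X (ltW p_gt1)))
    (y : nat -> lpsum X (ltW p_gt1)) :
  (forall n, B (y n)) -> (forall n, rnorm (y n) <= 1) ->
  (forall n, (1 - (2^-1 ^+ n.+1) `^ p) `^ p^-1 <= rnorm (y n n)) ->
  closure (conv_hull B) 0.
Proof.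
move=> By y1 yn; apply: closure_rnorm => e e0.
have [N Ne] := exists_powR_average_lt p e p_gt1 e0.
exists (N.+1%:R^-1 *: \sum_(n < N.+1) y n); split.
  by move=> M [Mcvx BM]; apply: (convex_set_average M y N Mcvx) => n; exact: BM.
rewrite sub0r rnormN rnormZ realpart_normV; apply: le_lt_trans Ne.
rewrite ler_wpM2l ?invr_ge0//.
(* Each y n is cut into its coordinate n and the remainder. *)
under eq_bigr => n _ do rewrite (lp_mask_predC (pred1 (n : nat)) (y n)).
rewrite big_split/= (le_trans (ler_rnormD _ _))// lerD//.
  exact: rnorm_diagonal_le.
apply: (le_trans (ler_rnorm_sum _ _)); apply: le_trans (sum_half_pow_le1 N.+1).
apply: ler_sum => n _; apply: rnorm_off_diagonal_le => //.
by apply: exprn_ile1; rewrite ?invr_ge0// invf_le1 ?ler1n.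
Qed.

End LpBall.

Theorem proposition3p7 (R : realType) (b : scalar_kind)
  (X : nat -> completeNormedModType (scalars R b))
  (X_neq0 : forall n, exists x : X n, x != 0)
  (p : R) (p_gt1 : 1 < p) :
  SCD (closed_unit_ball (lpsum X (ltW p_gt1))) 0.
Proof.
have p0 : 0 < p by exact: lt_trans p_gt1.
pose u n := sval (cid (exists_unit_vector (X n) (X_neq0 n))).
have u1 n : rnorm (u n) = 1.
  by exact: (svalP (cid (exists_unit_vector _ (X_neq0 n)))).
have /boolp.choice[F FP] : forall n,
  exists F : {linear lpsum X (ltW p_gt1) -> (scalars R b)^o},
    [/\ continuous F, forall y, realpart (F y) <= rnorm (y n) &
        realpart (F (lp_single u n)) = 1].
  move=> n; have [f [fle fre fu]] := exists_norming_functional (u n).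
  have [F Ff] := exists_coordinate_functional (ltW p_gt1) n f.
  exists F; split=> [|y|]; last 2 first.
  - by rewrite Ff.
  - by rewrite Ff /= eqxx fu.
  apply: contractive_continuous => y; rewrite Ff (le_trans (fle _))//.
  by rewrite ler_rnorm (rnorm_lpE y) le_rnorm_lp_rnorm.
pose c n : R := (1 - (2^-1 ^+ n.+1) `^ p) `^ p^-1.
have c1 n : c n < 1.
  have h0 : 0 <= 2^-1 ^+ n.+1 :> R by rewrite exprn_ge0.
  have h1 : 2^-1 ^+ n.+1 <= 1 :> R by rewrite exprn_ile1// invf_le1 ?ler1n.
  rewrite -[ltRHS](one_powR p^-1) gt0_ltr_powR ?invr_gt0 ?nnegrE//.
  by rewrite subr_ge0 -[leRHS](one_powR p) ge0_ler_powR ?nnegrE// ltW.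
pose S n := closed_unit_ball (lpsum X (ltW p_gt1)) `&`
  [set y | c n < realpart (F n y)].
have S0 n : S n !=set0.
  have [_ _ Fu] := FP n; exists (lp_single u n); split; last by rewrite /= Fu.
  by rewrite closed_unit_ballE /= (le_trans (rnorm_lp_single_le _ _))// u1.
split; first by rewrite closed_unit_ballE /= rnorm0.
exists S; split=> [n|]; last split=> [n|B Bball BS].
- split; first exact: S0.
  exists [set y | c n < realpart (F n y)] => //.
  have [Fc _ Fu] := FP n; exists (F n), (c n); split=> //.
  exists (lp_single u n); apply/eqP => Fu0.
  by move: Fu; rewrite Fu0 realpart0 => /eqP; rewrite eq_sym oner_eq0.
- by split; [move=> y []|exact: S0].
- have /boolp.choice[y yP] := BS.
  apply: (@closure_conv_hull0 _ _ _ _ _ _ y) => n;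
    have [By [yball ySn]] := yP n.
  + exact: By.
  + by move: yball; rewrite closed_unit_ballE.
  + have [_ Fle _] := FP n.
    by apply: ltW; apply: lt_le_trans (Fle (y n)).
Qed.
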